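(* Let $(Q,\cdot,\backslash,/)$ be an algebra with three binary operations such that the identities $$(y/x)\cdot x = y,\qquad x\backslash(x\cdot y) = y,\qquad x/(y\backslash x) = y$$ hold for all $x,y\in Q$. Then $(Q,\cdot,\backslash,/)$ is a quasigroup.
   Context: An algebra $(Q,\cdot,\backslash,/)$ is a set $Q$ with three binary operations $\cdot,\backslash,/ : Q\times Q\to Q$. Such an algebra is called a quasigroup (in the equational sense of T. Evans) if the following four identities hold for all $x,y\in Q$: $x\cdot(x\backslash y)=y$; $(y/x)\cdot x=y$; $x\backslash(x\cdot y)=y$; $(y\cdot x)/x=y$. *)

(* Defs.v *)
(* [ldiv x y] is x \ y and [rdiv y x] is y / x: in both cases [x] is the
   divisor, so the argument order follows the infix notation. *)
Record is_quasigroup (Q : Type) (mul ldiv rdiv : Q -> Q -> Q) : Prop := {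
  mul_ldiv : forall x y : Q, mul x (ldiv x y) = y;
  rdiv_mul : forall x y : Q, mul (rdiv y x) x = y;
  ldiv_mul : forall x y : Q, ldiv x (mul x y) = y;
  mul_rdiv : forall x y : Q, rdiv (mul y x) x = y
}.

(* Main.v *)
Require Import Defs.

Theorem theorem1 (Q : Type) (mul ldiv rdiv : Q -> Q -> Q)
  (h1 : forall x y : Q, mul (rdiv y x) x = y)
  (h2 : forall x y : Q, ldiv x (mul x y) = y)
  (h3 : forall x y : Q, rdiv x (ldiv y x) = y) :
  is_quasigroup Q mul ldiv rdiv.
Proof.
  split.
  - intros x y.
    (* Since y / (x \ y) = x, the product x (x \ y) is (y / (x \ y)) (x \ y). *)
    pose proof (h1 (ldiv x y) y) as E.
    rewrite h3 in E.
    exact E.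
  - exact h1.
  - exact h2.
  - intros x y.
    (* Since x = y \ (y x), the quotient (y x) / x is (y x) / (y \ (y x)). *)
    pose proof (h3 (mul y x) y) as E.
    rewrite h2 in E.
    exact E.
Qed.
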